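(* Let $A$ be a Novikov algebra and let $I$ be a minimal ideal of $A$. Then either $I^2=0$, or $I$ (regarded as an algebra in its own right) is a simple algebra.
   Context: Algebras are (not necessarily associative, not necessarily unital) algebras over a field. Write $(a,b,c)=(ab)c-a(bc)$. A Novikov algebra is an algebra satisfying the identities $(a,b,c)=(b,a,c)$ and $(ab)c=(ac)b$. ''Ideal'' means two-sided ideal; $I^2$ is the linear span of all products $xy$ with $x,y\in I$. A minimal ideal of $A$ is a nonzero ideal of $A$ that contains no ideals of $A$ other than $0$ and itself. An algebra $B$ is simple if $B^2\neq 0$ and $B$ has no ideals other than $0$ and $B$. *)

(* Defs.v *)
From HB Require Import structures.
From mathcomp Require Import all_boot all_order all_algebra.
From mathcomp Require Import boolp classical_sets.

Set Implicit Arguments.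
Unset Strict Implicit.
Unset Printing Implicit Defensive.

Import GRing.Theory.

Local Open Scope classical_set_scope.
Local Open Scope ring_scope.

(* Algebras over k of arbitrary dimension; neither associativity nor the
   existence of a unit is required. *)
HB.mixin Record Lmodule_isNAAlgebra (k : fieldType) A of GRing.Lmodule k A := {
  namul : A -> A -> A;
  namul_bilinear : bilinear_for *:%R *:%R namul
}.

#[short(type="naAlgType")]
HB.structure Definition NAAlgebra (k : fieldType) :=
  {A of GRing.Lmodule k A & Lmodule_isNAAlgebra k A}.

Declare Scope naalg_scope.
Delimit Scope naalg_scope with NA.
Notation "x ** y" := (namul x y)
  (at level 40, left associativity) : naalg_scope.
Local Open Scope naalg_scope.

Definition associator (k : fieldType) (A : naAlgType k) (a b c : A) : A :=
  (a ** b) ** c - a ** (b ** c).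

Definition novikov (k : fieldType) (A : naAlgType k) : Prop :=
  (forall a b c : A, associator a b c = associator b a c) /\
  (forall a b c : A, (a ** b) ** c = (a ** c) ** b).

Definition lin_span (k : fieldType) (V : lmodType k) (X : set V) : set V :=
  [set v | exists n (c : 'I_n -> k) (x : 'I_n -> V),
     (forall i, X (x i)) /\ v = \sum_(i < n) c i *: x i].

Definition sq (k : fieldType) (A : naAlgType k) (I : set A) : set A :=
  lin_span [set z | exists x y, [/\ I x, I y & z = x ** y]].

Definition is_ideal (k : fieldType) (A : naAlgType k) (I : set A) : Prop :=
  [/\ I 0,
      forall x y, I x -> I y -> I (x + y),
      forall (c : k) x, I x -> I (c *: x),
      forall a x, I x -> I (a ** x) &
      forall x a, I x -> I (x ** a)].

Record ideal (k : fieldType) (A : naAlgType k) := Ideal {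
  ideal_set :> set A;
  ideal_setP : is_ideal ideal_set
}.

Definition minimal_ideal (k : fieldType) (A : naAlgType k) (I : ideal A) : Prop :=
  I <> [set 0] :> set A /\
  (forall J : ideal A, J `<=` I -> J = [set 0] :> set A \/ J = I :> set A).

Definition simple_algebra (k : fieldType) (B : naAlgType k) : Prop :=
  sq [set: B] <> [set 0] /\
  (forall J : ideal B, J = [set 0] :> set B \/ J = [set: B] :> set B).

(* Membership x \in I is the boolean version of I x, by classical logic; it
   gives the ideal a carrier type with val : ideal_alg I -> A injective. *)
Section IdealAlgebra.
Variables (k : fieldType) (A : naAlgType k) (I : ideal A).

Definition ideal_pred : {pred A} := fun x => x \in ideal_set I.

Lemma ideal_submod_closed : submod_closed ideal_pred.
Proof.
have [I0 ID IZ _ _] := ideal_setP I.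
split; first exact: mem_set I0.
by move=> c x y /set_mem Ix /set_mem Iy; apply/mem_set/ID => //; exact: IZ.
Qed.

HB.instance Definition _ :=
  GRing.isSubmodClosed.Build k A ideal_pred ideal_submod_closed.

Definition ideal_alg : Type := {x : A | x \in ideal_pred}.

HB.instance Definition _ := SubChoice.on ideal_alg.
HB.instance Definition _ := [SubChoice_isSubLmodule of ideal_alg by <:].

Lemma ideal_mul_subproof (x y : ideal_alg) : val x ** val y \in ideal_pred.
Proof.
have [_ _ _ Il _] := ideal_setP I.
exact/mem_set/Il/set_mem/(valP y).
Qed.

Definition ideal_mul (x y : ideal_alg) : ideal_alg :=
  Sub (val x ** val y) (ideal_mul_subproof x y).

Lemma ideal_mul_bilinear : bilinear_for *:%R *:%R ideal_mul.
Proof.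
have [Hl Hr] := @namul_bilinear k A.
split=> u c x y; apply: val_inj; rewrite /=.
- exact: Hl (val u) c (val x) (val y).
- exact: Hr (val u) c (val x) (val y).
Qed.

HB.instance Definition _ :=
  Lmodule_isNAAlgebra.Build k ideal_alg ideal_mul_bilinear.

End IdealAlgebra.

(* Main.v *)
(* In a Novikov algebra [a(xy) = (ax)y - (xa)y + x(ay)] and [(xy)a = (xa)y], so
   the square of an ideal is an ideal and the minimality of [I] gives [I = II] as
   soon as [II <> 0]; likewise the left annihilator of [I] in itself is [0].  Let
   [J <> 0] be an ideal of the algebra [I].
   - If [JA] lies in [J], then the [x] in [I] with [xI] and [Ix] inside [J] form an
     ideal of [A] containing [J], hence equal to [I], and [I = II] lies in [J].
   - [IJ] is an ideal of [I] stable under the right multiplications of [A], as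
     [(ij)a = (ia)j]; so either [IJ = I], and [J = I], or [IJ = 0].
   - If [IJ = 0], then [(aj)i = (ai)j = 0] gives [AJ = 0], hence [(ja)i = j(ai)].
     Thus [JI] is a nonzero ideal of [A], and [J = I] again. *)
Require Import Defs.
From mathcomp Require Import all_boot all_order all_algebra.
From mathcomp Require Import boolp classical_sets.

Local Open Scope classical_set_scope.
Local Open Scope ring_scope.

Import GRing.Theory.
Local Open Scope naalg_scope.

(** * Subspaces and linear spans *)

Section Span.
Context {k : fieldType} {V : lmodType k}.
Implicit Types X S : set V.

Definition subspace S : Prop :=
  [/\ S 0, forall x y, S x -> S y -> S (x + y) & forall c x, S x -> S (c *: x)].

Lemma subspaceB S : subspace S -> forall x y, S x -> S y -> S (x - y).
Proof.
by move=> [_ SD SZ] x y Sx Sy; apply: SD => //; rewrite -scaleN1r; apply: SZ.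
Qed.

Lemma subspace_span X : subspace (lin_span X).
Proof.
split=> [|x y [n [c [u [Xu ->]]]] [m [d [v [Xv ->]]]]|c x [n [d [u [Xu ->]]]]].
- exists 0, (fun=> 0), (fun=> 0); split; last by rewrite big_ord0.
  by case.
- exists (n + m)%N,
    (fun i => match split i with inl j => c j | inr j => d j end),
    (fun i => match split i with inl j => u j | inr j => v j end).
  split=> [i|]; first by case: (split i).
  rewrite big_split_ord /=.
  by congr (_ + _); apply: eq_bigr => i _;
    rewrite ?(unsplitK (inl i)) ?(unsplitK (inr i)).
- exists n, (fun i => c * d i), u; split=> //.
  by rewrite scaler_sumr; apply: eq_bigr => i _; rewrite scalerA.
Qed.

Lemma sub_span X : X `<=` lin_span X.
Proof.
move=> x Xx; exists 1, (fun=> 1), (fun=> x); split=> //.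
by rewrite big_ord1 scale1r.
Qed.

Lemma span_sub X S : subspace S -> X `<=` S -> lin_span X `<=` S.
Proof.
move=> [S0 SD SZ] XS x [n [c [u [Xu ->]]]].
by apply: (big_ind S) => // i _; apply/SZ/XS.
Qed.

Lemma subspace_neq0 S : subspace S -> S <> [set 0] -> exists2 x, S x & x <> 0.
Proof.
move=> [S0 _ _] Sn0; apply: contrapT => nex; apply: Sn0; apply/seteqP; split.
  by move=> x Sx; apply: contrapT => xn0; apply: nex; exists x.
by move=> _ ->.
Qed.

End Span.

(** * Bilinearity of the product and ideals spanned by products *)

Section Mul.
Context {k : fieldType} {A : naAlgType k}.
Implicit Types (a x y : A) (c : k).

Lemma mul_lin_l y c x x' : (c *: x + x') ** y = c *: (x ** y) + x' ** y.
Proof. exact: (@namul_bilinear k A).1. Qed.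

Lemma mul_lin_r a c x x' : a ** (c *: x + x') = c *: (a ** x) + a ** x'.
Proof. exact: (@namul_bilinear k A).2. Qed.

Lemma mulDl x x' y : (x + x') ** y = x ** y + x' ** y.
Proof. by have := mul_lin_l y 1 x x'; rewrite !scale1r. Qed.

Lemma mulDr a x x' : a ** (x + x') = a ** x + a ** x'.
Proof. by have := mul_lin_r a 1 x x'; rewrite !scale1r. Qed.

Lemma mul0l y : 0 ** y = 0 :> A.
Proof. by apply: (@addIr _ (0 ** y)); rewrite -mulDl !add0r. Qed.

Lemma mul0r a : a ** 0 = 0 :> A.
Proof. by apply: (@addIr _ (a ** 0)); rewrite -mulDr !add0r. Qed.

Lemma mulZl c x y : (c *: x) ** y = c *: (x ** y).
Proof. by have := mul_lin_l y c x 0; rewrite mul0l !addr0. Qed.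

Lemma mulZr c a x : a ** (c *: x) = c *: (a ** x).
Proof. by have := mul_lin_r a c x 0; rewrite mul0r !addr0. Qed.

Lemma subspace_mull (S : set A) a :
  subspace S -> subspace [set x | S (a ** x)].
Proof.
move=> [S0 SD SZ]; split=> [|x y|c x] /=; first by rewrite mul0r.
  by rewrite mulDr; apply: SD.
by rewrite mulZr; apply: SZ.
Qed.

Lemma subspace_mulr (S : set A) a :
  subspace S -> subspace [set x | S (x ** a)].
Proof.
move=> [S0 SD SZ]; split=> [|x y|c x] /=; first by rewrite mul0l.
  by rewrite mulDl; apply: SD.
by rewrite mulZl; apply: SZ.
Qed.

Lemma subspace0 : subspace [set (0 : A)].
Proof.
by split=> [|_ _ -> ->|c _ ->] //=; rewrite ?addr0 ?scaler0.
Qed.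

Lemma ideal_subspace (I : set A) : is_ideal I -> subspace I.
Proof. by case. Qed.

Definition prod_set (X Y : set A) : set A :=
  [set z | exists x y, [/\ X x, Y y & z = x ** y]].

(** Multiplication by a fixed element on either side is linear, so the preimage of a span is a
    subspace and stability can be tested on generators. *)
Lemma span_ideal (X : set A) :
  (forall a x, X x -> lin_span X (a ** x)) ->
  (forall x a, X x -> lin_span X (x ** a)) -> is_ideal (lin_span X).
Proof.
move=> Xl Xr; have sX := subspace_span X; case: (sX) => X0 XD XZ.
split=> // [a|x a Xx].
  by apply: span_sub; [exact: subspace_mull | exact: Xl].
have /= : lin_span X `<=` [set x | lin_span X (x ** a)]; last exact.
by apply: span_sub; [exact: subspace_mulr | move=> y; exact: Xr].
Qed.

Lemma span_prodP (X Y : set A) x y :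
  X x -> Y y -> lin_span (prod_set X Y) (x ** y).
Proof. by move=> Xx Yy; apply: sub_span; exists x, y. Qed.

End Mul.

(** * Novikov algebras and their minimal ideals of nonzero square *)

Section Novikov.
Context {k : fieldType} {A : naAlgType k}.
Hypothesis hA : novikov A.
Implicit Types a b c : A.

Lemma rcomm a b c : (a ** b) ** c = (a ** c) ** b.
Proof. exact: hA.2. Qed.

(** Left symmetry of the associator solved for [a ** (b ** c)]: it moves a left multiplication
    inside a product. *)
Lemma lsym a b c : a ** (b ** c) = (a ** b) ** c - (b ** a) ** c + b ** (a ** c).
Proof.
by rewrite addrAC -addrA -(subKr ((a ** b) ** c) (a ** (b ** c)))
   -/(associator a b c) hA.1 /associator opprB addrCA.
Qed.

Section Minimal.
Variable I : set A.
Hypothesis idI : is_ideal I.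
Hypothesis minI : forall K : set A,
  is_ideal K -> K `<=` I -> K = [set 0] \/ K = I.
Hypothesis sqI : sq I <> [set 0].

Let sI : subspace I. Proof. exact: ideal_subspace idI. Qed.
Let Il a x : I x -> I (a ** x). Proof. by case: idI => *; auto. Qed.
Let Ir x a : I x -> I (x ** a). Proof. by case: idI => *; auto. Qed.

Lemma minimal_sub (K : set A) x :
  is_ideal K -> K `<=` I -> K x -> x <> 0 -> I `<=` K.
Proof.
move=> idK KI Kx xn0; case: (minI _ idK KI) => eqK.
  by move: Kx; rewrite eqK.
by rewrite eqK.
Qed.

Lemma ideal_sq : is_ideal (sq I).
Proof.
have sS : subspace (sq I) by exact: subspace_span.
have SP x y : I x -> I y -> sq I (x ** y) by exact: span_prodP.
apply: span_ideal => [a _ [x [y [Ix Iy ->]]]|_ a [x [y [Ix Iy ->]]]].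
  rewrite lsym; case: (sS) => _ SD _; apply: SD; last by auto.
  by apply: (subspaceB _ sS); apply: SP; auto.
by rewrite rcomm; apply: SP; auto.
Qed.

(** By minimality the nonzero ideal [sq I] is all of [I], so linear conditions on [I] need only be
    checked on products. *)
Lemma sub_of_prod (S : set A) : subspace S ->
  (forall x y, I x -> I y -> S (x ** y)) -> I `<=` S.
Proof.
move=> sS IIS; have sqsub (K : set A) : subspace K ->
    (forall x y, I x -> I y -> K (x ** y)) -> sq I `<=` K.
  by move=> sK IIK; apply: span_sub => // _ [x [y [Ix Iy ->]]]; auto.
have [x sqx xn0] := subspace_neq0 _ (subspace_span _) sqI.
apply: subset_trans (sqsub _ sS IIS).
by apply: minimal_sub sqx xn0; [exact: ideal_sq | apply: sqsub; auto].
Qed.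

Lemma annihilator_eq0 x : I x -> (forall y, I y -> x ** y = 0) -> x = 0.
Proof.
move=> Ix xI0; apply: contrapT => xn0; apply: sqI.
pose K : set A := [set z | I z /\ forall y, I y -> z ** y = 0].
have [I0 ID IZ] := sI.
have IK : I `<=` K.
  apply: (minimal_sub _ x) => // [|z []//].
  split=> [|z t [Iz z0] [It t0]|c z [Iz z0]|a z [Iz z0]|z a [Iz z0]];
      split=> [|y Iy]; auto.
  - by rewrite mul0l.
  - by rewrite mulDl z0 // t0 // addr0.
  - by rewrite mulZl z0 // scaler0.
  (* Here [z ** y], [z ** (a ** y)] and [(z ** a) ** y = (z ** y) ** a] all vanish, so left symmetry
     leaves only [(a ** z) ** y = 0]. *)
  - have := lsym a z y; rewrite z0 // (z0 (a ** y) (Il _ _ Iy)) mul0r.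
    by rewrite addr0 (rcomm z) z0 // mul0l subr0 => <-.
  - by rewrite rcomm z0 // mul0l.
apply/seteqP; split=> [|_ ->]; last by case: (subspace_span (prod_set I I)).
by apply: span_sub; [exact: subspace0 | move=> _ [u [v [/IK[_ u0] Iv ->]]]; exact: u0].
Qed.

(** An ideal of the algebra [I], kept as a subset of [A] so that its elements can be multiplied by
    elements outside [I]. *)
Definition inner_ideal (J : set A) : Prop :=
  [/\ subspace J, J `<=` I, forall i j, I i -> J j -> J (i ** j) &
      forall j i, J j -> I i -> J (j ** i)].

(* The set [V] of all [x] in [I] with [xI] and [Ix] inside [J] is an ideal of [A]: the
   right multiplications of [A] preserve it because they preserve [J], and the
   left ones because [(ax)i = (ai)x], and [(uv)(ax) = (u(ax))v] where
   [u(ax)] is in [J + AJ] and [(AJ)I] is inside [J]. *)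
Lemma right_stable_full (J : set A) : inner_ideal J ->
  (forall j a, J j -> J (j ** a)) -> (exists2 x, J x & x <> 0) -> I `<=` J.
Proof.
move=> [sJ JI IJ JIr] JA [x0 Jx0 x0n0]; have [I0 ID IZ] := sI.
have [J0 JD JZ] := sJ.
pose V : set A := [set x | [/\ I x, forall i, I i -> J (x ** i) &
                                    forall i, I i -> J (i ** x)]].
have AJI a j i : J j -> I i -> J ((a ** j) ** i).
  by move=> Jj Ii; rewrite rcomm; apply: IJ => //; apply: Il.
have IV : I `<=` V.
  apply: (minimal_sub _ x0) => //; last 2 first.
  - by move=> z [].
  - by split=> [|i Ii|i Ii]; auto.
  split=> [|x y [Ix xI Ix'] [Iy yI Iy']|c x [Ix xI Ix']|a x [Ix xI Ix']
          |x a [Ix xI Ix']]; split=> [|i Ii|i Ii]; auto.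
  - by rewrite mulDl; auto.
  - by rewrite mulDr; auto.
  - by rewrite mulZl; auto.
  - by rewrite mulZr; auto.
  - by rewrite rcomm; auto.
  - have sW := subspace_mulr _ (a ** x) sJ.
    apply: (sub_of_prod _ sW) Ii => u v Iu Iv /=.
    rewrite rcomm lsym mulDl; apply: JD; last by auto.
    by apply: JIr => //; apply: (subspaceB J); auto.
  - by rewrite rcomm; auto.
  - by rewrite lsym; apply: JD; [apply: (subspaceB J)|]; auto.
by apply: sub_of_prod => // x y /IV[_ xI _] Iy; apply: xI.
Qed.

Lemma inner_ideal_full (J : set A) : inner_ideal J ->
  (exists2 x, J x & x <> 0) -> I `<=` J.
Proof.
move=> hJ [x0 Jx0 x0n0]; have [sJ JI IJ JIr] := hJ.
pose T := lin_span (prod_set I J).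
have sT : subspace T by exact: subspace_span.
have TJ : T `<=` J by apply: span_sub => // _ [i [j [Ii Jj ->]]]; auto.
have Tr t a : T t -> T (t ** a).
  move=> Tt; have /= : T `<=` [set t | T (t ** a)]; last exact.
  apply: span_sub; first exact: subspace_mulr.
  by move=> _ [i [j [Ii Jj ->]]] /=; rewrite rcomm; apply: span_prodP; auto.
have [T0|nT0] := pselect (T = [set 0]); last first.
  apply: subset_trans (TJ); apply: right_stable_full => //; last first.
    exact: subspace_neq0.
  split=> // [t Tt|i j Ii Tj|j i Tj Ii]; [|apply: span_prodP|].
  - exact/JI/TJ.
  - by [].
  - exact: TJ.
  - exact: Tr.
have IJ0 i j : I i -> J j -> i ** j = 0.
  move=> Ii Jj; suff: T (i ** j) by rewrite T0.
  exact: span_prodP.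
(* For [y] in [I], [(a ** j) ** y = (a ** y) ** j] lies in [IJ = 0], so [a ** j] annihilates [I]. *)
have AJ0 a j : J j -> a ** j = 0.
  move=> Jj; apply: annihilator_eq0; first by auto.
  by move=> y Iy; rewrite rcomm IJ0; auto.
(* Since [j ** i] is again in [J], the terms of [lsym a j i] starting with [a] vanish. *)
have JAI j a i : J j -> I i -> (j ** a) ** i = j ** (a ** i).
  move=> Jj Ii; have := lsym a j i; rewrite (AJ0 a _ (JIr _ _ Jj Ii)) (AJ0 a _ Jj).
  by rewrite mul0l add0r => /esym/eqP; rewrite addrC subr_eq0 => /eqP.
pose S := lin_span (prod_set J I).
have SJ : S `<=` J by apply: span_sub => // _ [j [i [Jj Ii ->]]]; auto.
(* This product witnesses that [S] is nonzero; without it [x0] would annihilate [I]. *)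
have [y [Iy xyn0]] : exists y, I y /\ x0 ** y <> 0.
  apply: contrapT => nex; apply: x0n0; apply: annihilator_eq0; first exact: JI.
  by move=> y Iy; apply: contrapT => xyn0; apply: nex; exists y.
apply: subset_trans (SJ); apply: (minimal_sub _ (x0 ** y)) => //.
- apply: span_ideal => [a _ [j [i [Jj Ii ->]]]|_ a [j [i [Jj Ii ->]]]].
    by rewrite AJ0; [case: (subspace_span (prod_set J I)) | auto].
  by rewrite rcomm JAI //; apply: span_prodP; auto.
- by apply: subset_trans SJ JI.
- exact: span_prodP.
Qed.

End Minimal.
End Novikov.

Theorem theorem4 (k : fieldType) (A : naAlgType k) (hA : novikov A)
    (I : ideal A) (hI : minimal_ideal I) :
  sq I = [set 0] \/ simple_algebra (ideal_alg I).
Proof.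
have [|sqI] := pselect (sq I = [set 0]); [by left | right].
have valI (x : ideal_alg I) : ideal_set I (val x) by exact/set_mem/(valP x).
have surj x : ideal_set I x -> exists2 u : ideal_alg I, val u = x & True.
  by move=> Ix; exists (Sub x (mem_set Ix)).
have minI (K : set A) : is_ideal K -> K `<=` I -> K = [set 0] \/ K = I.
  by move=> idK; exact: (hI.2 (Ideal idK)).
split.
  (* Every product of two elements of [I] is the [val] of a product in [ideal_alg I], so a zero
     square there forces [sq I] to be zero. *)
  move=> sqB0; apply: sqI; apply/seteqP; split=> [|_ ->]; last first.
    by case: (subspace_span (prod_set I I)).
  apply: span_sub; first exact: subspace0.
  move=> _ [x [y [/surj[u <- _] /surj[v <- _] ->]]].
  have : sq [set: ideal_alg I] (u ** v) by exact: span_prodP.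
  by rewrite sqB0 => /(congr1 val).
move=> J; have [|nJ0] := pselect (J = [set 0] :> set (ideal_alg I)); [by left|right].
have idJ := ideal_setP J; have [J0 JD JZ Jl Jr] := idJ.
have [u Ju un0] := subspace_neq0 _ (ideal_subspace _ idJ) nJ0.
(* The image of [J] under [val] is a nonzero inner ideal; injectivity of [val] then carries the
   inclusion back to [J]. *)
have full : I `<=` val @` (J : set (ideal_alg I)).
  apply: (inner_ideal_full hA _ (ideal_setP I) minI sqI); last first.
    exists (val u); first by exists u.
    by move=> u0; apply: un0; apply: val_inj.
  split=> [|_ [x _ <-]|_ _ /surj[x <- _] [y Jy <-]|_ _ [y Jy <-] /surj[x <- _]].
  - split=> [|_ _ [x Jx <-] [y Jy <-]|c _ [x Jx <-]].
    + by exists 0.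
    + by exists (x + y) => //; exact: JD.
    + by exists (c *: x) => //; exact: JZ.
  - exact: valI.
  - by exists (x ** y) => //; exact: Jl.
  - by exists (y ** x) => //; exact: Jr.
apply/seteqP; split=> // x _.
by have [y Jy /val_inj <-] := full _ (valI x).
Qed.
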